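(* Let $\omega(x,y,z) = xyz - xzy + yzx$ (fourth family, $q=0$) and $\omega'(x,y,z) = (x\circ y)z$ with $u\circ v=\tfrac12(uv+vu)$ (Jordan family, $q=0$). Then $U(A^{\omega})\cong U(A^{\omega'})$ as unital associative algebras.
   Context: $\mathbb{F}$ is a field of characteristic $0$. $A$ is the 2-dimensional space of $2\times 2$ matrices over $\mathbb{F}$ with zero diagonal, with basis $e_1 = \begin{bmatrix} 0&1\\0&0\end{bmatrix}$, $e_2 = \begin{bmatrix} 0&0\\1&0\end{bmatrix}$; it is closed under triple products $xyz$ of matrices. For a trilinear operation $\omega(x,y,z)$ (a fixed rational linear combination of the six products of $x,y,z$ in all orders), $A^\omega$ denotes the space $A$ with the trilinear operation $\omega$ computed using matrix multiplication. Let $\mathbb{F}\langle a,b\rangle$ be the free unital associative algebra and $\phi\colon A \to \mathbb{F}\langle a,b\rangle$ the linear map with $\phi(e_1)=a$, $\phi(e_2)=b$. The universal associative envelope is $U(A^\omega) = \mathbb{F}\langle a,b\rangle / I$, where $I$ is the two-sided ideal generated by the elements $\omega(\phi(x),\phi(y),\phi(z)) - \phi(\omega(x,y,z))$ for $x,y,z\in\{e_1,e_2\}$. *)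

(* Defs.v *)
From HB Require Import structures.
From mathcomp Require Import all_boot all_order all_algebra.
From mathcomp Require Import generic_quotient ring_quotient.
From mathcomp Require Import boolp.
From mathcomp Require Import monalg.

Set Implicit Arguments.
Unset Strict Implicit.
Unset Printing Implicit Defensive.

Import GRing.Theory.
Local Open Scope ring_scope.
Local Open Scope quotient_scope.

(* ring_quotient only builds ring quotients of commutative rings; the        *)
(* following is its counterpart for two-sided ideals of an algebra.  The      *)
(* ideals are proper because MathComp algebras are non-trivial.               *)

HB.mixin Record isProperIdeal2 (R : nzRingType) (S : R -> bool) := {
  ideal2_1 : 1 \notin (S : {pred R});
  ideal2_mull : forall r x : R, x \in (S : {pred R}) -> r * x \in (S : {pred R});
  ideal2_mulr : forall r x : R, x \in (S : {pred R}) -> x * r \in (S : {pred R})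
}.

#[short(type="ideal2")]
HB.structure Definition Ideal2 (R : nzRingType) :=
  {S of GRing.ZmodClosed R S & isProperIdeal2 R S}.

Section QuotientAlgebra.
Variables (F : fieldType) (L : algType F) (I : ideal2 L).

Definition quot_alg := Quotient.quot I.

HB.instance Definition _ := GRing.Zmodule.on quot_alg.

Definition quot_pi (x : L) : quot_alg := \pi_(Quotient.quot I) x.
Let rp (u : quot_alg) : L := repr (u : Quotient.quot I).

Lemma quot_piP x y : quot_pi x = quot_pi y <-> x - y \in I.
Proof.
by rewrite Quotient.idealrBE; split=> [/eqP|/eqP].
Qed.

Lemma quot_pi_surj u : exists x, quot_pi x = u.
Proof. by exists (rp u); apply: reprK. Qed.

Let rpK u : quot_pi (rp u) = u. Proof. exact: reprK. Qed.

Let piB : {morph quot_pi : x y / x - y}.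
Proof. by move=> x y; rewrite /quot_pi (raddfB \pi_(Quotient.quot I)). Qed.

Let piD : {morph quot_pi : x y / x + y}.
Proof. by move=> x y; rewrite /quot_pi (raddfD \pi_(Quotient.quot I)). Qed.

Definition quot_mul (u v : quot_alg) : quot_alg := quot_pi (rp u * rp v).
Definition quot_scale (a : F) (u : quot_alg) : quot_alg := quot_pi (a *: rp u).

Let rp_pi x : rp (quot_pi x) - x \in I.
Proof. by apply/quot_piP; rewrite rpK. Qed.

Let piM x y : quot_pi (x * y) = quot_mul (quot_pi x) (quot_pi y).
Proof.
apply/esym/quot_piP.
have -> : rp (quot_pi x) * rp (quot_pi y) - x * y =
  rp (quot_pi x) * (rp (quot_pi y) - y) + (rp (quot_pi x) - x) * y.
  by rewrite mulrBr mulrBl addrA subrK.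
by apply: rpredD; [apply: ideal2_mull | apply: ideal2_mulr].
Qed.

Let piZ a x : quot_pi (a *: x) = quot_scale a (quot_pi x).
Proof.
apply/esym/quot_piP; rewrite -scalerBr -[_ - _]mul1r scalerAl.
exact: ideal2_mull.
Qed.

Let mulA : associative quot_mul.
Proof.
by move=> u v w; rewrite -[u]rpK -[v]rpK -[w]rpK -!piM mulrA.
Qed.
Let mul1 : left_id (quot_pi 1) quot_mul.
Proof. by move=> u; rewrite -[u]rpK -!piM mul1r. Qed.
Let mulr1' : right_id (quot_pi 1) quot_mul.
Proof. by move=> u; rewrite -[u]rpK -!piM mulr1. Qed.
Let mulDl : left_distributive quot_mul +%R.
Proof.
by move=> u v w; rewrite -[u]rpK -[v]rpK -[w]rpK -!(piD, piM) mulrDl.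
Qed.
Let mulDr : right_distributive quot_mul +%R.
Proof.
by move=> u v w; rewrite -[u]rpK -[v]rpK -[w]rpK -!(piD, piM) mulrDr.
Qed.
Let pi0 : quot_pi 0 = 0.
Proof. by rewrite -(subrr 0) piB subrr. Qed.
Let nz : quot_pi 1 != 0.
Proof.
by apply/eqP; rewrite -pi0 => /quot_piP; rewrite subr0 (negPf ideal2_1).
Qed.

HB.instance Definition _ :=
  GRing.Zmodule_isNzRing.Build quot_alg mulA mul1 mulr1' mulDl mulDr nz.

Let scaleA a b u : quot_scale a (quot_scale b u) = quot_scale (a * b) u.
Proof. by rewrite -[u]rpK -!piZ scalerA. Qed.
Let scale1 : left_id 1 quot_scale.
Proof. by move=> u; rewrite -[u]rpK -!piZ scale1r. Qed.
Let scaleDr : right_distributive quot_scale +%R.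
Proof. by move=> a u v; rewrite -[u]rpK -[v]rpK -!(piD, piZ) scalerDr. Qed.
Let scaleDl u : {morph quot_scale^~ u : a b / a + b}.
Proof. by move=> a b; rewrite -[u]rpK -!(piD, piZ) scalerDl. Qed.

HB.instance Definition _ :=
  GRing.Zmodule_isLmodule.Build F quot_alg scaleA scale1 scaleDr scaleDl.

Let scaleAl a (u v : quot_alg) : a *: (u * v) = a *: u * v.
Proof.
rewrite -[u]rpK -[v]rpK; change (quot_scale a (quot_mul (quot_pi (rp u)) (quot_pi (rp v))) =
  quot_mul (quot_scale a (quot_pi (rp u))) (quot_pi (rp v))).
by rewrite -!(piM, piZ) scalerAl.
Qed.
HB.instance Definition _ := GRing.Lmodule_isLalgebra.Build F quot_alg scaleAl.

Let scaleAr a (u v : quot_alg) : a *: (u * v) = u * (a *: v).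
Proof.
rewrite -[u]rpK -[v]rpK; change (quot_scale a (quot_mul (quot_pi (rp u)) (quot_pi (rp v))) =
  quot_mul (quot_pi (rp u)) (quot_scale a (quot_pi (rp v)))).
by rewrite -!(piM, piZ) scalerAr.
Qed.
HB.instance Definition _ := GRing.Lalgebra_isAlgebra.Build F quot_alg scaleAr.

HB.instance Definition _ := GRing.isZmodMorphism.Build L quot_alg quot_pi piB.
HB.instance Definition _ := GRing.isMonoidMorphism.Build L quot_alg quot_pi
  (erefl, piM).
HB.instance Definition _ := GRing.isScalable.Build F L quot_alg *:%R quot_pi piZ.

End QuotientAlgebra.

Section GeneratedIdeal.
Variables (R : nzRingType) (S : R -> Prop).

Definition two_sided_ideal (J : R -> Prop) : Prop :=
  [/\ J 0, forall x y, J x -> J y -> J (x + y),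
      forall r x, J x -> J (r * x) & forall r x, J x -> J (x * r)].

Definition gen_ideal : pred R := fun r =>
  `[< forall J, two_sided_ideal J -> (forall s, S s -> J s) -> J r >].

Lemma gen_idealP r : reflect
  (forall J, two_sided_ideal J -> (forall s, S s -> J s) -> J r)
  (r \in gen_ideal).
Proof. exact: asboolP. Qed.

Lemma gen_ideal_gen s : S s -> s \in gen_ideal.
Proof. by move=> Ss; apply/gen_idealP => J _; apply. Qed.

Lemma gen_ideal_zmod_closed : zmod_closed gen_ideal.
Proof.
split=> [|x y /gen_idealP Ix /gen_idealP Iy]; apply/gen_idealP => J HJ SJ.
  by case: HJ.
have [_ JD Jl _] := HJ.
by apply: JD; [exact: Ix | rewrite -mulN1r; apply: Jl; exact: Iy].
Qed.

Lemma gen_ideal_mull r x : x \in gen_ideal -> r * x \in gen_ideal.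
Proof.
move=> /gen_idealP Ix; apply/gen_idealP => J HJ SJ.
by have [_ _ Jl _] := HJ; apply: Jl; apply: Ix.
Qed.

Lemma gen_ideal_mulr r x : x \in gen_ideal -> x * r \in gen_ideal.
Proof.
move=> /gen_idealP Ix; apply/gen_idealP => J HJ SJ.
by have [_ _ _ Jr] := HJ; apply: Jr; apply: Ix.
Qed.

Lemma gen_ideal_proper (K : nzRingType) (f : {rmorphism R -> K}) :
  (forall s, S s -> f s = 0) -> 1 \notin gen_ideal.
Proof.
move=> fS; apply/negP => /gen_idealP /(_ (fun r => f r = 0)).
rewrite rmorph1 => H; suff /eqP : (1 : K) = 0 by rewrite oner_eq0.
apply: H => //; split; first by rewrite rmorph0.
- by move=> x y hx hy; rewrite rmorphD hx hy addr0.
- by move=> r x hx; rewrite rmorphM hx mulr0.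
- by move=> r x hx; rewrite rmorphM hx mul0r.
Qed.

End GeneratedIdeal.

Section FreeAlgebra.
Variable F : fieldType.

Definition free_alg := {malg F[{fmonom 'I_2}]}.

HB.instance Definition _ := GRing.Lalgebra.on free_alg.

Let malgC_comm (k : F) (x : free_alg) : x * k%:MP = k%:MP * x.
Proof.
rewrite !malgM_def fgmulUg fgmulgU; apply: eq_bigr => m _.
by rewrite mulm1 mul1m mulrC.
Qed.

Let free_scaleAr (k : F) (x y : free_alg) : k *: (x * y) = x * (k *: y).
Proof. by rewrite -!mul_malgC !mulrA malgC_comm. Qed.

HB.instance Definition _ := GRing.Lalgebra_isAlgebra.Build F free_alg free_scaleAr.

Definition gen_a : free_alg := << fmu 0 >>.
Definition gen_b : free_alg := << fmu 1 >>.

(* the augmentation gen_a, gen_b |-> 0; it shows that the ideals of relations *)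
(* below are proper                                                          *)
Definition free_aug : free_alg -> F := @mcoeff {fmonom 'I_2} F mone.

Let free_augB : zmod_morphism free_aug.
Proof. by move=> x y; apply: mcoeffB. Qed.
Let free_augM : monoid_morphism free_aug.
Proof.
by have [? ?] := @mcoeff1g_is_multiplicative {fmonom 'I_2} F; split.
Qed.
Lemma free_augD x y : free_aug (x + y) = free_aug x + free_aug y.
Proof. exact: mcoeffD. Qed.
Lemma free_augZ k x : free_aug (k *: x) = k * free_aug x.
Proof. exact: mcoeffZ. Qed.

HB.instance Definition _ := GRing.isZmodMorphism.Build free_alg F free_aug free_augB.
HB.instance Definition _ := GRing.isMonoidMorphism.Build free_alg F free_aug free_augM.

Lemma free_aug_gen_a : free_aug gen_a = 0.
Proof. by rewrite /free_aug mcoeffU1 fmP fmU fm1. Qed.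
Lemma free_aug_gen_b : free_aug gen_b = 0.
Proof. by rewrite /free_aug mcoeffU1 fmP fmU fm1. Qed.

End FreeAlgebra.

Section TrilinearOperation.
Variable F : fieldType.

Definition rational_comb (op : forall R : algType F, R -> R -> R -> R) : Prop :=
  exists c1 c2 c3 c4 c5 c6 : rat, forall (R : algType F) (x y z : R),
    op R x y z =
      ratr c1 *: (x * y * z) + ratr c2 *: (x * z * y) +
      ratr c3 *: (y * x * z) + ratr c4 *: (y * z * x) +
      ratr c5 *: (z * x * y) + ratr c6 *: (z * y * x).

(* An operation is given simultaneously on all algebras, since it is computed *)
(* both in 2 x 2 matrices and in the free algebra; the coefficients are the   *)
(* same for all of them.                                                      *)
Record trilinear_op := TrilinearOp {
  triop : forall R : algType F, R -> R -> R -> R;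
  triopP : rational_comb triop
}.

Fact omegaP :
  rational_comb (fun R x y z => x * y * z - x * z * y + y * z * x).
Proof.
exists 1, (-1), 0, 1, 0, 0 => R x y z.
have r1 : ratr 1 = 1 :> F by apply: (@ratr_nat F 1).
have r0 : ratr 0 = 0 :> F by apply: (@ratr_nat F 0).
have rN : ratr (-1) = -1 :> F by apply: (@ratr_int F (-1)).
by rewrite r1 r0 rN !scale1r !scale0r !addr0 scaleN1r.
Qed.

Definition omega : trilinear_op := TrilinearOp omegaP.

Definition jordan (R : algType F) (u v : R) : R := 2^-1 *: (u * v + v * u).

Fact omega'P : rational_comb (fun R x y z => jordan x y * z).
Proof.
exists 2^-1, 0, 2^-1, 0, 0, 0 => R x y z.
have r0 : ratr 0 = 0 :> F by apply: (@ratr_nat F 0).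
have rV : ratr 2^-1 = 2^-1 :> F by rewrite /ratr mul1r.
by rewrite r0 rV !scale0r !addr0 /jordan -scalerAl mulrDl scalerDr.
Qed.

Definition omega' : trilinear_op := TrilinearOp omega'P.

End TrilinearOperation.

Section ZeroDiagonal.
Variable F : fieldType.

Definition zero_diag : pred 'M[F]_2 := fun M => [forall i, M i i == 0].

Let zero_diag_submod : submod_closed zero_diag.
Proof.
split=> [|a M N /forallP HM /forallP HN]; apply/forallP => i.
  by rewrite mxE.
by rewrite !mxE (eqP (HM i)) (eqP (HN i)) mulr0 addr0.
Qed.

HB.instance Definition _ := GRing.isSubmodClosed.Build F 'M[F]_2 zero_diag
  zero_diag_submod.

Record zdiag := Zdiag { zdiag_val : 'M[F]_2; _ : zdiag_val \in zero_diag }.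

HB.instance Definition _ := [isSub for zdiag_val].
HB.instance Definition _ := [Choice of zdiag by <:].
HB.instance Definition _ := [SubChoice_isSubLmodule of zdiag by <:].

Lemma zero_diag_mul3 (x y z : 'M[F]_2) :
  x \in zero_diag -> y \in zero_diag -> z \in zero_diag ->
  x * y * z \in zero_diag.
Proof.
move=> /forallP hx /forallP hy /forallP hz; apply/forallP => i.
have sum2 (f : 'I_2 -> F) : \sum_j f j = f 0 + f 1.
  rewrite big_ord_recl big_ord1; congr (_ + f _).
  exact: val_inj.
have [[x0 x1] [y0 y1] [z0 z1]] :
    [/\ x 0 0 = 0 /\ x 1 1 = 0, y 0 0 = 0 /\ y 1 1 = 0
      & z 0 0 = 0 /\ z 1 1 = 0] by do ?split; apply/eqP.
have [->|->] : i = 0 \/ i = 1.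
  by case: i => [[|[|//]] ?]; [left|right]; apply: val_inj.
all: by rewrite -!mulmxE !(mxE, sum2) ?(x0, x1, y0, y1, z0, z1)
  !(mulr0, mul0r, addr0, add0r).
Qed.

Fact triop_zero_diag (w : trilinear_op F) (x y z : zdiag) :
  triop w (val x) (val y) (val z) \in zero_diag.
Proof.
have [c1 [c2 [c3 [c4 [c5 [c6 ->]]]]]] := triopP w.
have Z := zero_diag_mul3; have xP := valP x; have yP := valP y.
have zP := valP z.
apply: rpredD; last by apply: rpredZ; apply: Z.
apply: rpredD; last by apply: rpredZ; apply: Z.
apply: rpredD; last by apply: rpredZ; apply: Z.
apply: rpredD; last by apply: rpredZ; apply: Z.
by apply: rpredD; apply: rpredZ; apply: Z.
Qed.

Definition zdiag_op (w : trilinear_op F) (x y z : zdiag) : zdiag :=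
  Zdiag (triop_zero_diag w x y z).

Fact e1_subproof : (delta_mx 0 1 : 'M[F]_2) \in zero_diag.
Proof. by apply/forallP => -[[|[|//]] ?]; rewrite mxE. Qed.
Fact e2_subproof : (delta_mx 1 0 : 'M[F]_2) \in zero_diag.
Proof. by apply/forallP => -[[|[|//]] ?]; rewrite mxE. Qed.
Definition e1 : zdiag := Zdiag e1_subproof.
Definition e2 : zdiag := Zdiag e2_subproof.

Definition phi (x : zdiag) : free_alg F :=
  val x 0 1 *: gen_a F + val x 1 0 *: gen_b F.

Fact phi_is_linear : linear phi.
Proof.
have lin (V : lmodType F) (a b : V) (c : F) (M N : 'M[F]_2) :
    (c *: M + N) 0 1 *: a + (c *: M + N) 1 0 *: b =
    c *: (M 0 1 *: a + M 1 0 *: b) + (N 0 1 *: a + N 1 0 *: b).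
  by rewrite !mxE !scalerDl scalerDr !scalerA addrACA.
by move=> c x y; apply: lin.
Qed.
HB.instance Definition _ := GRing.isLinear.Build F zdiag (free_alg F) *:%R phi
  phi_is_linear.

Lemma phi_e1 : phi e1 = gen_a F.
Proof. by rewrite /phi !mxE /= scale1r scale0r addr0. Qed.
Lemma phi_e2 : phi e2 = gen_b F.
Proof. by rewrite /phi !mxE /= scale1r scale0r add0r. Qed.

End ZeroDiagonal.

Section Envelope.
Variables (F : fieldType) (w : trilinear_op F).

Definition env_rel (r : free_alg F) : Prop :=
  exists x y z : zdiag F,
    [/\ x \in [:: e1 F; e2 F], y \in [:: e1 F; e2 F], z \in [:: e1 F; e2 F] &
        r = triop w (phi x) (phi y) (phi z) - phi (zdiag_op w x y z)].

Definition env_ideal : pred (free_alg F) := gen_ideal env_rel.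

Lemma free_aug_phi (x : zdiag F) : free_aug (phi x) = 0.
Proof.
have aug (V : lmodType F) (f : V -> F) (a b : V) (u v : F) :
    {morph f : p q / p + q} -> (forall k p, f (k *: p) = k * f p) ->
    f a = 0 -> f b = 0 -> f (u *: a + v *: b) = 0.
  by move=> fD fZ fa fb; rewrite fD !fZ fa fb !mulr0 addr0.
exact: aug (@free_augD F) (@free_augZ F) (free_aug_gen_a F) (free_aug_gen_b F).
Qed.

Lemma triop_aug (R : algType F) (f : {rmorphism R -> F}) (x y z : R) :
  (forall k p, f (k *: p) = k * f p) ->
  f x = 0 -> f y = 0 -> f z = 0 -> f (triop w x y z) = 0.
Proof.
move=> fZ fx fy fz.
have [c1 [c2 [c3 [c4 [c5 [c6 ->]]]]]] := triopP w.
by rewrite !rmorphD /= !fZ !rmorphM /= fx fy fz !(mulr0, mul0r, addr0).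
Qed.

Fact env_ideal1 : 1 \notin env_ideal.
Proof.
apply: (@gen_ideal_proper _ _ F (@free_aug F)) => _ [x [y [z [_ _ _ ->]]]].
apply: etrans (raddfB (@free_aug F) _ _) _.
rewrite [X in _ - X]free_aug_phi subr0; apply: triop_aug; try exact: free_aug_phi.
exact: free_augZ.
Qed.

HB.instance Definition _ := GRing.isZmodClosed.Build (free_alg F) env_ideal
  (gen_ideal_zmod_closed env_rel).
HB.instance Definition _ := isProperIdeal2.Build (free_alg F) env_ideal
  env_ideal1 (@gen_ideal_mull _ env_rel) (@gen_ideal_mulr _ env_rel).

Definition envelope := quot_alg (Ideal2.clone _ env_ideal _).

HB.instance Definition _ := GRing.Algebra.on envelope.

End Envelope.

(* Main.v *)
(** Any three elements of [{e1, e2}] contain a repetition.  On arguments with a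
repetition, each of the two operations is, in every associative algebra, a fixed
linear combination of values of the other one on rearrangements of the same
arguments.  The defining relations of either envelope are therefore linear
combinations of those of the other, so the two ideals coincide. *)

Require Import Defs.
From mathcomp Require Import all_boot all_order all_algebra.
From HB Require Import structures.

Set Implicit Arguments.
Unset Strict Implicit.
Unset Printing Implicit Defensive.

Import GRing.Theory.
Local Open Scope ring_scope.

Section QuotientMap.
Variables (F : fieldType) (L : algType F) (I J : ideal2 L).
Hypothesis IJ : forall x : L, x \in I -> x \in J.

Definition quot_map (u : quot_alg I) : quot_alg J :=
  quot_pi J (repr (u : Quotient.quot I)).

(** Representatives of one class differ by an element of [I], hence of [J], so the choice made by
    [repr] does not matter. *)
Lemma quot_map_pi x : quot_map (quot_pi I x) = quot_pi J x.
Proof. by apply/quot_piP/IJ/quot_piP; apply: reprK. Qed.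

Let quot_map_zmod : zmod_morphism quot_map.
Proof.
move=> u v; have [[x <-] [y <-]] := (quot_pi_surj u, quot_pi_surj v).
by rewrite -raddfB !quot_map_pi raddfB.
Qed.

Let quot_map_monoid : monoid_morphism quot_map.
Proof.
split=> [|u v]; first by rewrite -(rmorph1 (quot_pi I)) quot_map_pi rmorph1.
have [[x <-] [y <-]] := (quot_pi_surj u, quot_pi_surj v).
by rewrite -rmorphM !quot_map_pi rmorphM.
Qed.

Let quot_map_scalable : scalable quot_map.
Proof.
move=> a u; have [x <-] := quot_pi_surj u.
by rewrite -linearZ !quot_map_pi linearZ.
Qed.

HB.instance Definition _ :=
  GRing.isZmodMorphism.Build (quot_alg I) (quot_alg J) quot_map quot_map_zmod.
HB.instance Definition _ :=
  GRing.isMonoidMorphism.Build (quot_alg I) (quot_alg J) quot_map quot_map_monoid.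
HB.instance Definition _ :=
  GRing.isScalable.Build F (quot_alg I) (quot_alg J) *:%R quot_map
    quot_map_scalable.

Lemma quot_alg_map : exists f : {lrmorphism quot_alg I -> quot_alg J},
  forall x, f (quot_pi I x) = quot_pi J x.
Proof. by exists quot_map; apply: quot_map_pi. Qed.

End QuotientMap.

(** The maps induced by the two inclusions send the class of [x] to the class of [x], so both
    composites fix every class. *)
Lemma quot_alg_iso (F : fieldType) (L : algType F) (I J : ideal2 L) :
  (forall x : L, x \in I -> x \in J) -> (forall x : L, x \in J -> x \in I) ->
  exists f : {lrmorphism quot_alg I -> quot_alg J}, bijective f.
Proof.
move=> /quot_alg_map[f fE] /quot_alg_map[g gE]; exists f.
by exists g => u; have [x <-] := quot_pi_surj u; rewrite ?(fE, gE).
Qed.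

Lemma gen_ideal_sub (R : nzRingType) (S : R -> Prop) (J : ideal2 R) :
  (forall s, S s -> s \in J) -> forall x, x \in gen_ideal S -> x \in J.
Proof.
move=> SJ x /gen_idealP/(_ (fun y => y \in J)); apply => //.
split; [exact: rpred0 | exact: rpredD | exact: ideal2_mull | exact: ideal2_mulr].
Qed.

Lemma ideal2_comb (F : fieldType) (L : algType F) (I : ideal2 L) (c d : F)
    (a b : L) : a \in I -> b \in I -> c *: a + d *: b \in I.
Proof.
(* A scalar multiple [c *: a] becomes the product [(c *: 1) * a], so that absorption on the left
   applies. *)
move=> Ia Ib; rewrite -[a]mul1r -[b]mul1r !scalerAl.
by apply: rpredD; apply: ideal2_mull.
Qed.

Section Relations.
Variables (F : fieldType) (w w' : trilinear_op F).

(** The three identities cover the possible positions of a repeated argument. The scalars are chosen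
    before [R], so that the same ones serve in the free algebra and in the matrix algebra. *)
Definition repeated_args_comb : Prop :=
  exists c d c' d' : F, forall (R : algType F) (x y : R),
    [/\ triop w x x y = triop w' x x y,
        triop w x y x = c *: triop w' x y x + d *: triop w' x x y &
        triop w y x x = c' *: triop w' x y x + d' *: triop w' x x y].

Definition relator (v : trilinear_op F) (x y z : zdiag F) : free_alg F :=
  triop v (phi x) (phi y) (phi z) - phi (zdiag_op v x y z).

Lemma relator_eq (x y z x1 y1 z1 : zdiag F) :
  triop w (phi x) (phi y) (phi z) = triop w' (phi x1) (phi y1) (phi z1) ->
  triop w (val x) (val y) (val z) = triop w' (val x1) (val y1) (val z1) ->
  relator w x y z = relator w' x1 y1 z1.
Proof.
move=> Ephi Eval; rewrite /relator Ephi.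
by have -> : zdiag_op w x y z = zdiag_op w' x1 y1 z1 by exact: val_inj.
Qed.

(** A relator has a term computed in the free algebra and a term computed with matrices. The
    identity is assumed in both places, and the linearity of [phi] carries the second one over to
    the free algebra. *)
Lemma relator_comb (c d : F) (x y z x1 y1 z1 x2 y2 z2 : zdiag F) :
  triop w (phi x) (phi y) (phi z) =
    c *: triop w' (phi x1) (phi y1) (phi z1) +
    d *: triop w' (phi x2) (phi y2) (phi z2) ->
  triop w (val x) (val y) (val z) =
    c *: triop w' (val x1) (val y1) (val z1) +
    d *: triop w' (val x2) (val y2) (val z2) ->
  relator w x y z = c *: relator w' x1 y1 z1 + d *: relator w' x2 y2 z2.
Proof.
have combB (V U : lmodType F) (f : {linear U -> V}) (a a1 a2 : V) (u u1 u2 : U) :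
    a = c *: a1 + d *: a2 -> u = c *: u1 + d *: u2 ->
    a - f u = c *: (a1 - f u1) + d *: (a2 - f u2).
  by move=> -> ->; rewrite linearD !linearZ !scalerBr opprD addrACA.
move=> Ephi Eval; apply: (combB _ _ (@phi F)) Ephi _.
exact: val_inj.
Qed.

Lemma env_ideal_sub : repeated_args_comb ->
  forall r, r \in env_ideal w -> r \in env_ideal w'.
Proof.
move=> [c [d [c' [d' wE]]]].
pose E := [:: e1 F; e2 F].
pose J : ideal2 (free_alg F) := Ideal2.clone _ (env_ideal w') _.
have rJ x y z : x \in E -> y \in E -> z \in E -> relator w' x y z \in J.
  by move=> Ex Ey Ez; apply: gen_ideal_gen; exists x, y, z; split.
apply: (@gen_ideal_sub _ _ J) => _ [x [y [z [Ex Ey Ez ->]]]].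
rewrite -[_ - _]/(relator w x y z).
have [->|[->|->]] : x = y \/ x = z \/ y = z.
- move: Ex Ey Ez; rewrite !inE.
  by do 3!case/orP=> /eqP->; auto.
- have [Ephi _ _] := wE _ (phi y) (phi z).
  have [Eval _ _] := wE _ (val y) (val z).
  by rewrite (relator_eq Ephi Eval); apply: rJ.
- have [_ Ephi _] := wE _ (phi z) (phi y).
  have [_ Eval _] := wE _ (val z) (val y).
  by rewrite (relator_comb Ephi Eval); apply: ideal2_comb; apply: rJ.
- have [_ _ Ephi] := wE _ (phi z) (phi x).
  have [_ _ Eval] := wE _ (val z) (val x).
  by rewrite (relator_comb Ephi Eval); apply: ideal2_comb; apply: rJ.
Qed.

End Relations.

Section RepeatedArguments.
Variable F : fieldType.
Hypothesis two_neq0 : 2 != 0 :> F.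

Let jordan_xx (R : algType F) (x : R) : jordan x x = x * x.
Proof. by rewrite /jordan -mulr2n -scaler_nat scalerA mulVf ?scale1r. Qed.

Lemma omega_repeated_args : repeated_args_comb (omega F) (omega' F).
Proof.
(* With [w] for [omega] and [w'] for [omega']: [w x x y = xxy = w' x x y],
   [w x y x = (xyx + yxx) - xxy] where the bracket is twice [w' x y x], and in [w y x x] the two
   terms [yxx] cancel, leaving [xxy]. *)
exists 2, (-1), 0, 1 => R x y; split.
- by rewrite /= jordan_xx subrK.
- rewrite /= jordan_xx /jordan -scalerAl scalerA mulfV // scale1r scaleN1r.
  by rewrite mulrDl addrAC.
- by rewrite /= jordan_xx subrr add0r scale0r add0r scale1r.
Qed.

Lemma omega'_repeated_args : repeated_args_comb (omega' F) (omega F).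
Proof.
(* Adding [xxy] cancels the negative term of [omega] at [x y x]. Half of the resulting sum is the
   value of [omega'] at [x y x] and also at [y x x], as the Jordan product is symmetric; hence four
   equal witnesses. *)
have E (R : algType F) (x y : R) : x * y * x + y * x * x =
    triop (omega F) x y x + triop (omega F) x x y.
  by rewrite /= [x * x * y - _ + _]subrK addrAC subrK.
exists 2^-1, 2^-1, 2^-1, 2^-1 => R x y; rewrite -scalerDr -E; split.
- by rewrite /= jordan_xx subrK.
- by rewrite /= /jordan -scalerAl mulrDl.
- by rewrite /= /jordan -scalerAl mulrDl addrC.
Qed.

End RepeatedArguments.

Theorem proposition5p8 (F : fieldType) (charF0 : [pchar F]%R =i pred0) :
  exists f : {lrmorphism envelope (omega F) -> envelope (omega' F)}, bijective f.
Proof.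
have two_neq0 : 2 != 0 :> F.
  (* If 2 vanished in [F], the prime 2 would lie in [[pchar F]]. *)
  by apply/eqP=> F2; have := charF0 2; rewrite !inE /= F2 eqxx.
apply: quot_alg_iso; apply: env_ideal_sub.
- exact: omega_repeated_args.
- exact: omega'_repeated_args.
Qed.
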